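(* Let $K$ and $L$ be infinite compact Hausdorff spaces. Then there is a sequence $\langle\mu_n\colon n\in\mathbb{N}\rangle$ of finitely supported, normalized, signed measures on $K\times L$ which is weak* convergent to $0$, that is, $\int_{K\times L}f\,d\mu_n\to 0$ as $n\to\infty$ for every continuous function $f\colon K\times L\to\mathbb{R}$.
   Context: $\mathbb{N}=\{0,1,2,\ldots\}$. For a compact Hausdorff space $X$, $C(X)$ is the Banach space of continuous real-valued functions on $X$ with the supremum norm. A measure on a Tychonoff space $X$ is an additive real-valued function $\mu$ on the Borel $\sigma$-field of $X$ that is inner regular with respect to closed sets, outer regular with respect to open sets, and has bounded variation, i.e. $\|\mu\|=\sup\{|\mu(A)|+|\mu(B)|\colon A,B \text{ disjoint Borel sets}\}<\infty$. A measure is normalized if $\|\mu\|=1$, and is called signed if it attains negative values. A measure is finitely supported if $\mu=\sum_{i=1}^m\alpha_i\delta_{x_i}$ for some pairwise distinct points $x_1,\ldots,x_m\in X$ and reals $\alpha_1,\ldots,\alpha_m$, where $\delta_x$ is the one-point (Dirac) measure at $x$; in this case $\|\mu\|=\sum_{i=1}^m|\alpha_i|$. Weak* convergence of measures refers to the weak* topology of the dual Banach space $C(X)^*$. *)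

(* Defs.v *)
From HB Require Import structures.
From mathcomp Require Import all_boot all_order all_algebra.
From mathcomp Require Import all_classical all_reals all_analysis.

Set Implicit Arguments.
Unset Strict Implicit.
Unset Printing Implicit Defensive.

Import Order.TTheory GRing.Theory Num.Theory.
Import numFieldNormedType.Exports.

Local Open Scope classical_set_scope.
Local Open Scope ring_scope.

(* Not declared in the library; the underlying topology is its product topology. *)
HB.instance Definition _ (K L : ptopologicalType) := Pointed.on (K * L)%type.

(* [measurableType] is pointed, hence [ptopologicalType]; this only excludes
   the empty space. *)
Definition borel (X : ptopologicalType) := g_sigma_algebraType (@open X).

(* Real-valued (countably) additive functions on the Borel sets of X; the
   values taken outside the Borel sets are never used below. *)
Notation borel_charge X R := (@charge _ (borel X) R).

Section BorelCharges.
Context {R : realType} {X : ptopologicalType}.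
Implicit Types mu : borel_charge X R.

(* For a signed [mu], approximating the value [mu A] alone would be too weak:
   the whole remainder [A `\` F], resp. [U `\` A], must be small, that is, [mu]
   must be small on each of its Borel subsets. *)
Definition closed_inner_regular mu :=
  forall (A : set (borel X)) (e : R), measurable A -> 0 < e ->
  exists F : set X, [/\ closed F, F `<=` A &
    forall B : set (borel X), measurable B -> B `<=` A `\` F ->
      (`|mu B| < e%:E)%E].

Definition open_outer_regular mu :=
  forall (A : set (borel X)) (e : R), measurable A -> 0 < e ->
  exists U : set X, [/\ open U, A `<=` U &
    forall B : set (borel X), measurable B -> B `<=` U `\` A ->
      (`|mu B| < e%:E)%E].

Definition charge_norm mu : \bar R :=
  ereal_sup [set y | exists A B : set (borel X),
    [/\ measurable A, measurable B, A `&` B = set0 &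
        y = (`|mu A| + `|mu B|)%E]].

Definition regular_measure mu :=
  [/\ closed_inner_regular mu, open_outer_regular mu &
      (charge_norm mu < +oo)%E].

Definition normalized mu := charge_norm mu = 1%E.

Definition signed mu :=
  exists A : set (borel X), measurable A /\ (mu A < 0)%E.

Definition finitely_supported mu :=
  exists (m : nat) (x : 'I_m -> borel X) (a : 'I_m -> R),
    injective x /\
    forall A : set (borel X), measurable A ->
      mu A = (\sum_(i < m) (a i)%:E * \d_(x i) A)%E.

Definition hahn_pos mu : set (borel X) := sval (cid (Hahn_decomposition mu)).

Definition hahn_neg mu : set (borel X) :=
  sval (cid (svalP (cid (Hahn_decomposition mu)))).

Definition hahnP mu : hahn_decomposition mu (hahn_pos mu) (hahn_neg mu) :=
  svalP (cid (svalP (cid (Hahn_decomposition mu)))).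

(* By [Hahn_decomposition_uniq] the value does not depend on the chosen Hahn
   decomposition. *)
Definition charge_integral mu (f : X -> R) : R :=
  \int[jordan_pos (hahnP mu)]_x f x - \int[jordan_neg (hahnP mu)]_x f x.

End BorelCharges.

(* Main.v *)
Require Import Defs.
From mathcomp Require Import all_boot all_order all_algebra.
From mathcomp Require Import all_classical all_reals all_analysis.
From mathcomp Require Import measurable_realfun ring lra.
Import Order.TTheory GRing.Theory Num.Theory.
Import numFieldNormedType.Exports.
Local Open Scope classical_set_scope.
Local Open Scope ring_scope.

(* Choose distinct points x_s of K, one for each sign vector s in {-1,1}^n, and
   distinct points y_1, ..., y_n of L, and give (x_s, y_i) the weight
   s_i / (n 2^n).  For bounded v, the orthogonality of the coordinate signs gives
   E |(1/n) sum_i s_i v_i|^2 <= sup |v|^2 / n.  By compactness the sections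
   f(x, .) of a continuous f are uniformly approximated by finitely many of
   them, f(z, .) with z in a finite set independent of n, so the integral of f
   is at most epsilon plus finitely many means E |(1/n) sum_i s_i f(z, y_i)|,
   all of which tend to 0. *)

(** * Finite combinations of point masses: integral, Jordan parts, total variation *)

Section DiracSum.
Context {R : realType} {d : measure_display} {Y : measurableType d}.
Context {T : finType}.
Implicit Types (a : T -> R) (x : T -> Y) (A : set Y).
Implicit Types nu : {measure set Y -> \bar R}.

Definition dirac_sum a x A : R := \sum_t a t * \1_A (x t).

Lemma dirac_sumE a x A :
  (\sum_t (a t)%:E * \d_(x t) A)%E = (dirac_sum a x A)%:E.
Proof.
by rewrite /dirac_sum -sumEFin; apply: eq_bigr => t _; rewrite diracE EFinM.
Qed.

Lemma dirac_sum_charge a x :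
  exists mu : {charge set Y -> \bar R}, forall A, mu A = (dirac_sum a x A)%:E.
Proof.
suff [mu muE] : exists mu : {charge set Y -> \bar R}, forall A,
    mu A = (\sum_(t <- enum T) (a t)%:E * \d_(x t) A)%E.
  by exists mu => A; rewrite muE big_enum dirac_sumE.
elim: (enum T) => [|t s [mu muE]].
  by exists czero => A; rewrite big_nil.
exists (cadd (cscale (a t) (charge_of_finite_measure \d_(x t))) mu) => A.
by rewrite big_cons -muE.
Qed.

Lemma dirac_sum_notin a x A : (forall t, ~ A (x t)) -> dirac_sum a x A = 0.
Proof.
move=> Ax; rewrite /dirac_sum big1// => t _.
by rewrite indicE memNset ?mulr0.
Qed.

Lemma ge0_integral_dirac_sum nu a x (f : Y -> R) :
  (forall t, 0 <= a t) ->
  (forall A, measurable A -> nu A = (dirac_sum a x A)%:E) ->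
  (forall z, 0 <= f z) -> measurable_fun setT f ->
  (\int[nu]_z (f z)%:E)%E = (\sum_t a t * f (x t))%:E.
Proof.
move=> a0 nuE f0 mf.
(* [msum] sums an initial segment of a sequence of measures, so the scaled Dirac measures are
   numbered through [enum_val] and continued by the zero measure. *)
pose m_ k : {measure set Y -> \bar R} :=
  oapp (fun i : 'I_#|T| => [the {measure set _ -> \bar R} of
    mscale (NngNum (a0 (enum_val i))) \d_(x (enum_val i))])
    [the {measure set _ -> \bar R} of mzero] (insub k).
have mE (i : 'I_#|T|) : m_ i = [the {measure set _ -> \bar R} of
    mscale (NngNum (a0 (enum_val i))) \d_(x (enum_val i))].
  by rewrite /m_ valK.
have mEf : measurable_fun setT (EFin \o f) by exact/measurable_EFinP.
rewrite (@eq_measure_integral _ _ _ _ (msum m_ #|T|)); last first.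
  move=> A mA _; rewrite nuE// -dirac_sumE /msum.
  rewrite (reindex _ (onW_bij _ (@enum_val_bij T))).
  by apply: eq_bigr => i _; rewrite mE.
rewrite ge0_integral_measure_sum//; last by move=> z _; rewrite lee_fin.
rewrite -sumEFin (reindex _ (onW_bij _ (@enum_val_bij T))).
apply: eq_bigr => i _; rewrite mE ge0_integral_mscale//; last first.
  by move=> z _; rewrite lee_fin.
by rewrite integral_dirac// diracT mul1e EFinM.
Qed.

Lemma Rintegral_dirac_sum nu a x (f : Y -> R) :
  (forall t, 0 <= a t) ->
  (forall A, measurable A -> nu A = (dirac_sum a x A)%:E) ->
  measurable_fun setT f ->
  \int[nu]_z f z = \sum_t a t * f (x t).
Proof.
move=> a0 nuE mf; rewrite /Rintegral integralE.
under eq_integral do rewrite funeposE -EFin_max.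
under [X in (_ - X)%E]eq_integral do rewrite funenegE -EFinN -EFin_max.
rewrite !(@ge0_integral_dirac_sum _ a x)//.
- rewrite -EFinB/= -sumrB; apply: eq_bigr => t _.
  rewrite -mulrBr; congr (_ * _).
  by rewrite !maxEle; do 2 case: ifPn; rewrite -?ltNge => h h'; lra.
- by move=> z; rewrite le_max lexx orbT.
- exact: measurable_funrneg.
- by move=> z; rewrite le_max lexx orbT.
- exact: measurable_funrpos.
Qed.

Context (mu : {charge set Y -> \bar R}) (a : T -> R) (x : T -> Y).
Hypothesis muE : forall A, measurable A -> mu A = (dirac_sum a x A)%:E.
Hypothesis x_inj : injective x.
Hypothesis mx : forall t, measurable [set x t].

Lemma charge_atom t : mu [set x t] = (a t)%:E.
Proof.
rewrite muE// /dirac_sum (bigD1 t)//= big1 ?addr0.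
  by rewrite indicE mem_set// mulr1.
move=> s st; rewrite indicE memNset ?mulr0//= => /x_inj/eqP.
by apply/negP.
Qed.

Context {P N : set Y} (PN : hahn_decomposition mu P N).

(** An atom lying in [P] is a measurable subset of a positive set, so its charge, which is [a t]
    because [x] is injective, is nonnegative. The set [N] is treated symmetrically. *)
Lemma hahn_pos_ge0 t : 0 <= a t * \1_P (x t).
Proof.
have [[mP Ppos] _ _ _] := PN.
rewrite indicE; case: (boolP (x t \in P)) => [|_]; last by rewrite mulr0.
rewrite inE => Pt; rewrite mulr1 -lee_fin -charge_atom.
by apply: Ppos => // _ ->.
Qed.

Lemma hahn_neg_ge0 t : 0 <= - a t * \1_N (x t).
Proof.
have [_ [mN Nneg] _ _] := PN.
rewrite indicE; case: (boolP (x t \in N)) => [|_]; last by rewrite mulr0.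
rewrite inE => Nt; rewrite mulr1 oppr_ge0 -lee_fin -charge_atom.
by apply: Nneg => // _ ->.
Qed.

Lemma hahn_indic t : \1_P (x t) + \1_N (x t) = 1 :> R.
Proof.
have [_ _ PUN PIN] := PN.
have : (P `|` N) (x t) by rewrite PUN.
have : ~ (P `&` N) (x t) by rewrite PIN.
rewrite !indicE => nPN [Pt|Nt].
  by rewrite mem_set// memNset ?addr0// => Nt; apply: nPN.
by rewrite memNset ?add0r ?mem_set// => Pt; apply: nPN.
Qed.

(** The Jordan parts are again Dirac sums at the same points, with the nonnegative weights
    [a t * \1_P (x t)] and [- a t * \1_N (x t)]. Their difference restores [a t], since each point
    lies in exactly one of [P] and [N]. *)
Lemma jordan_dirac_sum (f : Y -> R) : measurable_fun setT f ->
  \int[jordan_pos PN]_z f z - \int[jordan_neg PN]_z f z = \sum_t a t * f (x t).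
Proof.
move=> mf.
have [[mP _] [mN _] _ _] := PN.
rewrite (@Rintegral_dirac_sum _ (fun t => a t * \1_P (x t)) x)//; last 2 first.
- exact: hahn_pos_ge0.
- move=> A mA.
  (* [crestr0] takes the value 0 off the measurable sets; [mA] selects the other branch. *)
  transitivity (mu (A `&` P)).
    by rewrite [LHS]jordan_posE cjordan_posE /crestr0 mem_set.
  rewrite muE; last exact: measurableI.
  congr EFin; apply: eq_bigr => t _.
  by rewrite indicI/= -mulrA [\1_A _ * _]mulrC.
rewrite (@Rintegral_dirac_sum _ (fun t => - a t * \1_N (x t)) x)//; last 2 first.
- exact: hahn_neg_ge0.
- move=> A mA.
  transitivity (- mu (A `&` N))%E.
    by rewrite [LHS]jordan_negE cjordan_negE /crestr0 mem_set.
  rewrite muE; last exact: measurableI.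
  rewrite -EFinN -sumrN; congr EFin; apply: eq_bigr => t _.
  by rewrite indicI/= !mulNr -mulrA [\1_A _ * _]mulrC.
rewrite -sumrB; apply: eq_bigr => t _.
have := hahn_indic t; nra.
Qed.

(** Disjoint sets share no atom, so the weight [|a t|] is counted at most once. The bound is
    attained at [P] and [N], where all the weights have constant sign and nothing cancels. *)
Lemma charge_norm_dirac_sum :
  ereal_sup [set y | exists A B : set Y, [/\ measurable A, measurable B,
    A `&` B = set0 & y = (`|mu A| + `|mu B|)%E]] = (\sum_t `|a t|)%:E.
Proof.
have [[mP _] [mN _] _ PIN] := PN.
have norm_indic (C : set Y) t : `|\1_C (x t)| = \1_C (x t) :> R.
  by rewrite indicE normr_nat.
apply/eqP; rewrite eq_le; apply/andP; split.
  apply: ge_ereal_sup => _ [A [B [mA mB AB0 ->]]].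
  rewrite !muE// -EFinD lee_fin.
  have le_dirac_sum C : `|dirac_sum a x C| <= \sum_t `|a t| * \1_C (x t).
    rewrite (le_trans (ler_norm_sum _ _ _))//; apply: ler_sum => t _.
    by rewrite normrM norm_indic.
  rewrite (le_trans (lerD (le_dirac_sum A) (le_dirac_sum B)))//.
  rewrite -big_split/=; apply: ler_sum => t _.
  rewrite -mulrDr ler_piMr// !indicE.
  case: (boolP (x t \in A)) => [|_]; last by rewrite add0r lern1 leq_b1.
  rewrite inE => At; rewrite memNset ?addr0// => Bt.
  by have : (A `&` B) (x t) by []; rewrite AB0.
apply: ereal_sup_ubound; exists P, N; split=> //.
have sumP : dirac_sum a x P = \sum_t `|a t| * \1_P (x t).
  apply: eq_bigr => t _; have /ger0_norm := hahn_pos_ge0 t.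
  by rewrite normrM norm_indic.
have sumN : - dirac_sum a x N = \sum_t `|a t| * \1_N (x t).
  rewrite -sumrN; apply: eq_bigr => t _; have /ger0_norm := hahn_neg_ge0 t.
  by rewrite normrM normrN norm_indic mulNr.
rewrite !muE// -EFinD -[X in _ = (_ + X)%:E]normrN sumP sumN !ger0_norm.
- rewrite -big_split/=; congr EFin; apply: eq_bigr => t _.
  by rewrite -mulrDr hahn_indic mulr1.
- by apply: sumr_ge0 => t _; rewrite mulr_ge0.
- by apply: sumr_ge0 => t _; rewrite mulr_ge0.
Qed.

End DiracSum.

(** * Borel charges with finitely many atoms on a space whose finite sets are closed *)

Section BorelDiracSum.
Context {R : realType} {X : ptopologicalType} {T : finType}.
Context (mu : borel_charge X R) (a : T -> R) (x : T -> X).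
Hypothesis muE : forall A : set (borel X), measurable A ->
  mu A = (dirac_sum a (x : T -> borel X) A)%:E.
Hypothesis closed_finite : forall A : set X, finite_set A -> closed A.
Hypothesis x_inj : injective x.

Lemma open_borel (U : set X) : open U -> measurable (U : set (borel X)).
Proof. by move=> oU; apply: sub_sigma_algebra. Qed.

Lemma continuous_borel (f : X -> R) : continuous f ->
  measurable_fun [set: borel X] (f : borel X -> R).
Proof.
move=> /continuousP cf.
apply: (measurability _ (RGenOpens.measurableE R)).
move=> _ [_ [b [c ->] <-]]; rewrite setTI.
by apply: open_borel; apply: cf; exact: interval_open.
Qed.

Lemma measurable_point t : measurable ([set x t] : set (borel X)).
Proof.
rewrite -[X in measurable X]setCK; apply: measurableC; apply: open_borel.
by apply: closed_openC; apply: closed_finite; exact: finite_set1.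
Qed.

Lemma finite_image_finType (A : set T) : finite_set (x @` A).
Proof. exact/finite_image/finite_finset. Qed.

(** The closed set consists of the atoms inside [A], and the open set is the complement of the atoms
    outside [A]. Both remainders are free of atoms, so [mu] vanishes on all their Borel subsets. *)
Lemma regular_dirac_sum : regular_measure mu.
Proof.
split.
- move=> A e mA e0; exists (x @` [set t | A (x t)]); split.
  + by apply: closed_finite; exact: finite_image_finType.
  + by move=> _ [t At <-].
  + move=> B mB BA; rewrite muE// dirac_sum_notin ?abse0 ?lte_fin//.
    by move=> t /BA [At]; apply; exists t.
- move=> A e mA e0; exists (~` (x @` [set t | ~ A (x t)])); split.
  + by apply: closed_openC; apply: closed_finite; exact: finite_image_finType.
  + by move=> z Az [t nAt] xtz; apply: nAt; rewrite xtz.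
  + move=> B mB BA; rewrite muE// dirac_sum_notin ?abse0 ?lte_fin//.
    by move=> t /BA [+ nAt]; apply; exists t.
- by rewrite /charge_norm (charge_norm_dirac_sum _ _ _ muE x_inj measurable_point (hahnP mu)) ltry.
Qed.

Lemma finitely_supported_dirac_sum : finitely_supported mu.
Proof.
exists #|T|, (x \o enum_val), (a \o enum_val); split.
  exact: inj_comp x_inj enum_val_inj.
move=> A mA; rewrite muE// -dirac_sumE.
by rewrite (reindex _ (onW_bij _ (@enum_val_bij T))).
Qed.

Lemma normalized_dirac_sum : \sum_t `|a t| = 1 -> normalized mu.
Proof.
move=> a1; rewrite /normalized /charge_norm.
by rewrite (charge_norm_dirac_sum _ _ _ muE x_inj measurable_point (hahnP mu)) a1.
Qed.

Lemma signed_dirac_sum t : a t < 0 -> signed mu.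
Proof.
move=> at0; exists [set x t]; split; first exact: measurable_point.
by rewrite (charge_atom _ _ _ muE x_inj measurable_point) lte_fin.
Qed.

Lemma charge_integral_dirac_sum (f : X -> R) : continuous f ->
  charge_integral mu f = \sum_t a t * f (x t).
Proof.
move=> /continuous_borel.
exact: (jordan_dirac_sum _ _ _ muE x_inj measurable_point (hahnP mu)).
Qed.

End BorelDiracSum.

(** * Averages over all sign vectors *)

Section RandomSigns.
Context {R : realType} {n : nat}.
Local Notation signs := {ffun 'I_n -> bool}.
Implicit Types (s : signs) (i j : 'I_n) (v : 'I_n -> R).

Definition sign_mean s v : R := n%:R^-1 * \sum_i (-1) ^+ s i * v i.

(** For distinct [i] and [j], flipping the sign at [i] permutes the sign vectors and negates every
    term, so the sum equals its own opposite. *)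
Lemma sum_sign_mul i j :
  \sum_(s : signs) (-1) ^+ s i * (-1) ^+ s j
    = (i == j)%:R * #|{: signs}|%:R :> R.
Proof.
case: eqVneq => [->|ij]; last first.
  pose flip s : signs := [ffun k => (k == i) (+) s k].
  have flipK : involutive flip.
    by move=> s; apply/ffunP => k; rewrite !ffunE addbA addbb.
  set S := LHS.
  have : S = - S.
    rewrite {1}/S (reindex_inj (inv_inj flipK)) -sumrN.
    apply: eq_bigr => s _; rewrite !ffunE eqxx [j == i]eq_sym (negbTE ij).
    by rewrite addTb signrN mulNr.
  by rewrite mul0r; move: S => S; lra.
rewrite mul1r -sum1_card natr_sum; apply: eq_bigr => s _.
by rewrite -expr2 sqrr_sign.
Qed.

Lemma sum_sign_sqr v :
  \sum_(s : signs) (\sum_i (-1) ^+ s i * v i) ^+ 2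
    = #|{: signs}|%:R * \sum_i v i ^+ 2.
Proof.
have sum_pair i j :
    \sum_(s : signs) ((-1) ^+ s i * v i) * ((-1) ^+ s j * v j)
      = (i == j)%:R * #|{: signs}|%:R * (v i * v j).
  rewrite -sum_sign_mul mulr_suml; apply: eq_bigr => s _.
  by rewrite mulrACA.
under eq_bigr => s _ do rewrite expr2 big_distrlr/=.
rewrite exchange_big mulr_sumr; apply: eq_bigr => i _.
rewrite exchange_big; under eq_bigr do rewrite sum_pair.
rewrite (bigD1 i)//= big1 ?addr0 => [|j ji]; first by rewrite eqxx mul1r expr2.
by rewrite eq_sym (negbTE ji) !mul0r.
Qed.

Hypothesis n_gt0 : (0 < n)%N.

(* AM-GM: [|t| <= d + t ^ 2 / d] replaces Cauchy-Schwarz. *)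
Lemma mean_norm_sign_mean v M d : 0 < d -> (forall i, `|v i| <= M) ->
  #|{: signs}|%:R^-1 * \sum_(s : signs) `|sign_mean s v|
    <= d + M ^+ 2 / (n%:R * d).
Proof.
move=> d0 vM.
have c0 : 0 < #|{: signs}|%:R :> R.
  by rewrite ltr0n; apply/card_gt0P; exists [ffun=> true].
have n0 : 0 < n%:R :> R by rewrite ltr0n.
have nE : n%:R = \sum_(i < n) 1 :> R by rewrite sumr_const card_ord.
have amgm (t : R) : `|t| <= d + t ^+ 2 / d.
  rewrite -(ler_pM2r d0) mulrDl divfK ?gt_eqF// -[t ^+ 2]real_normK ?num_real//.
  have := sqr_ge0 (`|t| - d); have := sqr_ge0 (`|t|); have := sqr_ge0 d; nra.
rewrite mulrC ler_pdivrMr//.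
apply: (le_trans (ler_sum _ (fun s _ => amgm (sign_mean s v)))).
rewrite big_split/= sumr_const -mulr_suml.
(* Orthogonality removes the cross terms of the second moment; the factor [1/n^2] against [n]
   squares of size at most [M ^+ 2] leaves the decay [M ^+ 2 / n]. *)
have -> : \sum_(s : signs) sign_mean s v ^+ 2
    = n%:R^-1 ^+ 2 * (#|{: signs}|%:R * \sum_i v i ^+ 2).
  by rewrite -sum_sign_sqr mulr_sumr; apply: eq_bigr => s _; rewrite exprMn.
have : \sum_i v i ^+ 2 <= n%:R * M ^+ 2.
  rewrite nE mulr_suml; apply: ler_sum => i _.
  by rewrite mul1r -real_normK ?num_real// lerXn2r ?nnegrE// (le_trans _ (vM i)).
rewrite -[d *+ _]mulr_natr mulrDl lerD2l => vnM.
rewrite ler_pdivrMr//.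
apply: (@le_trans _ _ (n%:R^-1 ^+ 2 * (#|{: signs}|%:R * (n%:R * M ^+ 2)))).
  by rewrite !ler_pM2l ?exprn_gt0 ?invr_gt0.
by rewrite le_eqVlt; apply/orP; left; apply/eqP; field; rewrite !gt_eqF.
Qed.

(** The vector [g s] varies with [s], so orthogonality does not apply to it directly. It is
    replaced, at cost [e], by some [w z] with [z] depending on [s]; adding the absolute values over
    all of [r] removes this dependence, and each fixed [w z] is covered by [mean_norm_sign_mean]. *)
Lemma mean_sign_mean_le (Z : eqType) (r : seq Z) (g : signs -> 'I_n -> R)
    (w : Z -> 'I_n -> R) M e d : 0 < d ->
  (forall z i, `|w z i| <= M) ->
  (forall s, exists2 z, z \in r & forall i, `|g s i - w z i| <= e) ->
  `|#|{: signs}|%:R^-1 * \sum_(s : signs) sign_mean s (g s)|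
    <= e + (size r)%:R * (d + M ^+ 2 / (n%:R * d)).
Proof.
move=> d0 wM gw.
have c0 : 0 < #|{: signs}|%:R :> R.
  by rewrite ltr0n; apply/card_gt0P; exists [ffun=> true].
have n0 : 0 < n%:R :> R by rewrite ltr0n.
have nE : n%:R = \sum_(i < n) 1 :> R by rewrite sumr_const card_ord.
have approx s : `|sign_mean s (g s)| <= e + \sum_(z <- r) `|sign_mean s (w z)|.
  have [z zr gwz] := gw s.
  have -> : sign_mean s (g s) =
      sign_mean s (fun i => g s i - w z i) + sign_mean s (w z).
    rewrite /sign_mean -mulrDr -big_split/=; congr (_ * _).
    by apply: eq_bigr => i _; rewrite -mulrDr subrK.
  rewrite (le_trans (ler_normD _ _))// lerD//.
    rewrite /sign_mean normrM gtr0_norm ?invr_gt0// mulrC ler_pdivrMr//.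
    rewrite (le_trans (ler_norm_sum _ _ _))// nE mulr_sumr; apply: ler_sum => i _.
    by rewrite normrM normr_sign mul1r mulr1.
  by rewrite (big_rem z)//= lerDl sumr_ge0.
rewrite normrM gtr0_norm ?invr_gt0//.
apply: (@le_trans _ _ (#|{: signs}|%:R^-1 *
    \sum_(s : signs) (e + \sum_(z <- r) `|sign_mean s (w z)|))).
  rewrite ler_pM2l ?invr_gt0// (le_trans (ler_norm_sum _ _ _))//.
  by apply: ler_sum => s _.
rewrite big_split/= sumr_const mulrDr -[e *+ _]mulr_natl mulKf ?gt_eqF// lerD2l.
rewrite exchange_big mulr_sumr -[size r]count_predT -sum1_count natr_sum mulr_suml.
by apply: ler_sum => z _; rewrite mul1r; apply: mean_norm_sign_mean.
Qed.

End RandomSigns.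

(** * Compactness and separation in the product *)

Section Topology.
Context {R : realType} {K L : ptopologicalType}.
Hypothesis Kcompact : compact [set: K].
Hypothesis Lcompact : compact [set: L].

(** A tube argument: continuity at [(z, y)] controls a box around it, and compactness of [L], in
    near-covering form, makes the neighbourhood of [z] uniform in [y]. The halves of [e] arise
    because [f (x, y')] and [f (z, y')] are both compared with [f (z, y)]. *)
Lemma compact_row_near (f : K * L -> R) (e : R) (z : K) :
  continuous f -> 0 < e ->
  \forall x \near z, forall y, `|f (x, y) - f (z, y)| < e.
Proof.
move=> cf e0; have e20 : 0 < e / 2 by rewrite divr_gt0.
move/compact_near_coveringP : Lcompact.
move=> /(_ K (nbhs z) (fun x y => `|f (x, y) - f (z, y)| < e) _).
have h (y : L) : [set: L] y -> \forall y' \near y & x \near z,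
    `|f (x, y') - f (z, y')| < e.
  move=> _; have /cvgrPdist_lt/(_ _ e20) := cf (z, y).
  case=> -[U V] [/= zU yV] UV; exists (V, U) => //= -[y' x] [/= Vy' Ux].
  have := UV (x, y') (conj Ux Vy'); have := UV (z, y') (conj (nbhs_singleton zU) Vy').
  rewrite /=; set a := f _; set b := f _; set c := f _ => ? ?.
  rewrite (_ : c - b = (a - b) - (a - c)); last by ring.
  by rewrite (le_lt_trans (ler_normB _ _))// [e]splitr ltrD.
by move=> /(_ h); apply: filterS => x + y => /(_ y I).
Qed.

Lemma compact_finite_rows (f : K * L -> R) (e : R) :
  continuous f -> 0 < e ->
  exists r : seq K, forall x, exists2 z, z \in r &
    forall y, `|f (x, y) - f (z, y)| < e.
Proof.
move=> cf e0; move: Kcompact; rewrite compact_cover.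
(* Interiors make the cover open by construction; [compact_row_near] puts [z] in [U z]. *)
pose U z := interior [set x | forall y, `|f (x, y) - f (z, y)| < e].
move=> /(_ K [set: K] U) [].
- by move=> z _; exact: open_interior.
- by move=> z _; exists z => //; exact: compact_row_near.
move=> D _ KD; exists (finmap.enum_fset D) => x.
by have [z Dz /interior_subset xz] := KD x I; exists z.
Qed.

Lemma compact_prod_bounded (f : K * L -> R) : continuous f ->
  exists M, 0 < M /\ forall z, `|f z| <= M.
Proof.
move=> cf; have cKL : compact [set: K * L].
  by rewrite -setXTT; exact: compact_setX.
have /compact_bounded[M [_ Mf]] : compact (f @` [set: K * L]).
  by apply: continuous_compact => //; exact: continuous_subspaceT.
(* [Mf] gives a bound for each real strictly above [M], which may be negative; this one is also
   positive. *)
exists (`|M| + 1); split; first by rewrite ltr_wpDl.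
move=> z; apply: Mf; last by exists z.
by rewrite (le_lt_trans (ler_norm _))// ltrDl.
Qed.

(** Distinct pairs differ in a coordinate, and a separating open set of that factor pulls back along
    the projection; hence the product is T1. *)
Lemma closed_finite_prod : hausdorff_space K -> hausdorff_space L ->
  forall A : set (K * L), finite_set A -> closed A.
Proof.
move=> /hausdorff_accessible KT1 /hausdorff_accessible LT1.
apply/accessible_finite_set_closed => -[x y] [x' y'].
rewrite xpair_eqE negb_and => /orP[/KT1[U [oU xU x'U]]|/LT1[V [oV yV y'V]]].
  exists (fst @^-1` U); split.
  - by apply: open_comp => // ? _; exact: cvg_fst.
  - by rewrite inE/= -inE.
  - by rewrite inE/= -inE.
exists (snd @^-1` V); split.
- by apply: open_comp => // ? _; exact: cvg_snd.
- by rewrite inE/= -inE.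
- by rewrite inE/= -inE.
Qed.

End Topology.

(** * The weighted grid of points in the product *)

Section SignGrid.
Context {R : realType} {K L : Type} (g : nat -> K) (h : nat -> L) (n : nat).
Local Notation grid := ({ffun 'I_n.+1 -> bool} * 'I_n.+1)%type.

(** Numbering the sign vectors by [enum_rank] lets one sequence [g] serve every [n]. The dimension
    [n.+1] keeps the grid nonempty at [n = 0]. *)
Definition grid_point (t : grid) : K * L := (g (enum_rank t.1), h t.2).

Definition grid_weight (t : grid) : R := (-1) ^+ t.1 t.2 / #|{: grid}|%:R.

Lemma grid_point_inj : injective g -> injective h -> injective grid_point.
Proof.
move=> gI hI [s i] [s' i'] [/gI/val_inj/enum_rank_inj -> /hI/val_inj ->] //.
Qed.

Lemma card_grid_gt0 : (0 < #|{: grid}|)%N.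
Proof. by apply/card_gt0P; exists ([ffun=> true], ord0). Qed.

Lemma sum_grid_weight_norm : \sum_t `|grid_weight t| = 1.
Proof.
under eq_bigr do rewrite normrM normr_sign mul1r normfV normr_nat.
rewrite sumr_const -[LHS]mulr_natr mulVf// pnatr_eq0 -lt0n.
exact: card_grid_gt0.
Qed.

Lemma grid_weight_lt0 : exists t, grid_weight t < 0.
Proof.
exists ([ffun=> true], ord0).
rewrite /grid_weight ffunE expr1 mulN1r oppr_lt0 invr_gt0 ltr0n.
exact: card_grid_gt0.
Qed.

(** The grid has as many points as sign vectors times [n.+1], so the normalizing factor splits into
    the one averaging over [s] and the one inside [sign_mean]. *)
Lemma sum_grid_weight_mul (f : K * L -> R) :
  \sum_t grid_weight t * f (grid_point t) =
    #|{: {ffun 'I_n.+1 -> bool}}|%:R^-1 *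
    \sum_(s : {ffun 'I_n.+1 -> bool})
      sign_mean s (fun i => f (g (enum_rank s), h i)).
Proof.
rewrite /sign_mean mulr_sumr.
under [RHS]eq_bigr do rewrite mulrA mulr_sumr.
rewrite pair_bigA; apply: eq_bigr => -[s i] _ /=.
rewrite /grid_weight card_prod card_ord natrM invfM/=.
by rewrite [RHS]mulrA; congr (_ * _); exact: mulrC.
Qed.

End SignGrid.

(** * Construction of the sequence and its convergence *)

Lemma infinite_set_inj_nat (X : ptopologicalType) : infinite_set [set: X] ->
  exists g : nat -> X, injective g.
Proof.
move=> /infiniteP/pcard_injP[g gI]; exists g => m k; apply: gI; exact: mem_set.
Qed.

Theorem theorem1p2 (R : realType) (K L : ptopologicalType)
    (Kinf : infinite_set [set: K]) (Linf : infinite_set [set: L])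
    (Kcompact : compact [set: K]) (Lcompact : compact [set: L])
    (KT2 : hausdorff_space K) (LT2 : hausdorff_space L) :
  exists mu : nat -> borel_charge (K * L)%type R,
    (forall n, [/\ regular_measure (mu n), finitely_supported (mu n),
                   normalized (mu n) & signed (mu n)]) /\
    (forall f : (K * L)%type -> R, continuous f ->
       charge_integral (mu n) f @[n --> \oo] --> 0).
Proof.
have [g gI] := infinite_set_inj_nat _ Kinf.
have [h hI] := infinite_set_inj_nat _ Linf.
have fin_closed := closed_finite_prod KT2 LT2.
have [mu muE] := choice (fun n =>
  dirac_sum_charge (grid_weight n : _ -> R) (grid_point g h n : _ -> borel (K * L)%type)).
have muE' n A (_ : measurable A) := muE n A.
have pI n := grid_point_inj g h n gI hI.
exists mu; split=> [n|f cf].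
  have [t t0] := @grid_weight_lt0 R n.
  split.
  - exact: (regular_dirac_sum _ _ _ (muE' n) fin_closed (pI n)).
  - exact: (finitely_supported_dirac_sum _ _ _ (muE' n) (pI n)).
  - exact: (normalized_dirac_sum _ _ _ (muE' n) fin_closed (pI n) (sum_grid_weight_norm n)).
  - exact: (signed_dirac_sum _ _ _ (muE' n) fin_closed (pI n) t t0).
apply/cvgr0Pnorm_le => e e0.
have [M [M0 fM]] := compact_prod_bounded Kcompact Lcompact f cf.
have e20 : 0 < e / 2 by rewrite divr_gt0.
have [r rP] := compact_finite_rows Kcompact Lcompact f (e / 2) cf e20.
pose p : R := (size r)%:R.
have p0 : 0 <= p by rewrite ler0n.
(* Chosen so that [p * d <= e / 4]; the [+ 1] covers [p = 0]. As [r] and [M] do not depend on [n],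
   neither does [d]. *)
pose d := e / (4 * (p + 1)).
have d0 : 0 < d by rewrite divr_gt0// mulr_gt0// ltr_wpDl.
(* The threshold for [n]: from [c <= n.+1] on, the variance term [p * (M ^+ 2 / (n.+1%:R * d))] is
   at most [e / 4]. *)
pose c := p * M ^+ 2 * 4 / (d * e).
near=> n.
rewrite (charge_integral_dirac_sum _ _ _ (muE' n) fin_closed (pI n) f cf).
rewrite sum_grid_weight_mul.
apply: le_trans (@mean_sign_mean_le _ _ _ _ r _
  (fun z i => f (z, h i)) M (e / 2) d d0 _ _) _ => //.
  move=> s; have [z zr fz] := rP (g (enum_rank s)).
  by exists z => // i; exact/ltW/fz.
rewrite -/p.
have n0 : 0 < n.+1%:R :> R by rewrite ltr0n.
have pd : p * d <= e / 4.
  have -> : e / 4 = (p + 1) * d by rewrite /d; field; lra.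
  by rewrite ler_pM2r// lerDl.
have pM : p * (M ^+ 2 / (n.+1%:R * d)) <= e / 4.
  have -> : p * (M ^+ 2 / (n.+1%:R * d)) = c / n.+1%:R * (e / 4).
    by rewrite /c; field; rewrite !gt_eqF.
  rewrite ler_piMl//; first by rewrite divr_ge0// ltW.
  rewrite ler_pdivrMr// mul1r (@le_trans _ _ n%:R) ?ler_nat//.
  near: n; exact: nbhs_infty_ger.
rewrite [leRHS](_ : e = e / 2 + (e / 4 + e / 4)); last by field.
by rewrite lerD2l mulrDr lerD.
Unshelve. all: by end_near.
Qed.
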